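(* Let $C_1 \subseteq C_2 \subseteq \dots$ be an increasing sequence of b-convex bodies in a Minkowski space $(\mathbb{R}^n, \| \cdot \|)$ such that $$\dim \left(\operatorname{aff}\left(\operatorname{bh}_1 \left(\bigcup^\infty_{i=1}C_i\right)\right)\right) \in \{0,1, n-1,n\}.$$ Then $$\operatorname{cl} \left(\bigcup^\infty_{i=1} C_i\right) = \operatorname{bh}_1 \left(\bigcup^\infty_{i=1} C_i\right).$$ In particular, $\operatorname{cl}\left(\bigcup^\infty_{i=1} C_i\right)$ is a b-convex body.
   Context: A Minkowski space $(\mathbb{R}^n,\|\cdot\|)$ is $\mathbb{R}^n$, $n\ge 1$, equipped with an arbitrary norm. For $x\in\mathbb{R}^n$ and $r\ge 0$, $B(x,r)=\{y:\|y-x\|\le r\}$ is the closed ball; $\operatorname{cl}$ denotes closure and $\operatorname{aff}$ affine hull. The ball hull of $S\subseteq\mathbb{R}^n$ is $\operatorname{bh}_1(S)=\bigcap_{x\in\mathbb{R}^n:\,S\subseteq B(x,1)}B(x,1)$, where the intersection of an empty family is $\mathbb{R}^n$. A set $S$ is b-convex if $S=\operatorname{bh}_1(S)$; a b-convex body is a bounded non-empty b-convex set. *)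

(* Defs.v *)
From HB Require Import structures.
From mathcomp Require Import all_boot all_order all_algebra.
From mathcomp Require Import all_classical all_reals all_analysis.

Set Implicit Arguments.
Unset Strict Implicit.
Unset Printing Implicit Defensive.

Import Order.TTheory GRing.Theory Num.Theory.
Import numFieldNormedType.Exports.

Local Open Scope classical_set_scope.
Local Open Scope ring_scope.

Record rV_norm (R : realType) (n : nat) := RVNorm {
  rV_norm_fun :> 'rV[R]_n -> R;
  rV_normD : forall x y, rV_norm_fun (x + y) <= rV_norm_fun x + rV_norm_fun y;
  rV_normZ : forall (a : R) x, rV_norm_fun (a *: x) = `|a| * rV_norm_fun x;
  rV_norm0_eq0 : forall x, rV_norm_fun x = 0 -> x = 0
}.

(* The row vectors 'rV[R]_n already carry the sup norm and its topology in the
   library.  [normed_rV N] is a copy on which the norm, the topology (closure)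
   and boundedness are those induced by N; the linear structure is unchanged. *)
Definition normed_rV (R : realType) (n : nat) (N : rV_norm R n) : Type :=
  'rV[R]_n.

HB.instance Definition _ (R : realType) (n : nat) (N : rV_norm R n) :=
  Vector.copy (normed_rV N) 'rV[R]_n.

HB.instance Definition _ (R : realType) (n : nat) (N : rV_norm R n) :=
  Lmodule_isNormed.Build R (normed_rV N)
    (@rV_normD R n N) (@rV_normZ R n N) (@rV_norm0_eq0 R n N).

(* [closed_ball_ Num.norm x 1] is [set y | `|x - y| <= 1]; an intersection over an
   empty family of centres is setT. *)
Definition ball_hull (R : realType) (V : normedModType R) (S : set V) : set V :=
  \bigcap_(x in [set x : V | S `<=` closed_ball_ Num.norm x 1])
    closed_ball_ Num.norm x 1.

Definition b_convex (R : realType) (V : normedModType R) (S : set V) : Prop :=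
  S = ball_hull S.

Definition b_convex_body (R : realType) (V : normedModType R) (S : set V) :
    Prop :=
  [/\ b_convex S, bounded_set S & S !=set0].

Definition affine_hull (R : realType) (V : lmodType R) (S : set V) : set V :=
  [set x | exists (k : nat) (a : 'I_k -> R) (s : 'I_k -> V),
     [/\ forall i, S (s i), \sum_(i < k) a i = 1
       & x = \sum_(i < k) a i *: s i]].

Definition has_affine_dim (R : realType) (V : vectType R) (A : set V) (d : nat)
    : Prop :=
  exists (x0 : V) (U : {vspace V}),
    A = [set x0 + u | u in [set u : V | u \in U]] /\ \dim U = d.

(* Main.v *)
Require Import Defs.
From HB Require Import structures.
From mathcomp Require Import all_boot all_order all_algebra.
From mathcomp Require Import all_classical all_reals all_analysis.
From mathcomp Require Import ring lra.

(** Write S for the union of the C_i and H for its ball hull.  H is closed, so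
    cl S is contained in H, and cl S has the same ball hull as S; everything
    reduces to H being contained in cl S.

    Balls are compact in finite dimension.  Hence, if B(x_i, 1) contains C_i
    for every i, the x_i have a cluster point l, and B(l, 1) contains every C_i
    [ball_center_cluster]; in particular some unit ball contains S.

    If H lies on a line, let p be a point of H outside cl S and k a point of S.
    The unit ball around S meets the line in a chord at least as long as S.
    Slide the ball back along the line until the end of the chord lies
    between S and p: the ball still contains S but not p any more,
    which contradicts p in H [ball_hull_line_sub_closure].

    If aff H has codimension at most one, every relative interior point p of H
    already belongs to some C_i [ball_hull_core_sub_bigcup].  Otherwise each
    C_i, being an intersection of unit balls, is contained in some B(x_i, 1)
    that misses p.  For a cluster point l of the x_i, B(l, 1) contains H, while
    |p - l| >= 1.  So the norm of q = p - l is 1, and since p is relatively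
    interior, the slice of the unit ball by q + U, where U is the direction of
    aff H, contains a neighbourhood of q and lies in the unit sphere: it is a
    facet.  Consequently all of q + U has norm at least 1
    [facet_norm_ge1], and q lies outside U.  In full dimension this is absurd;
    in codimension one, U and q span the space.
    Decompose x_j - l as s q + v with v in U; both parts are small for suitable
    j.  A point of C_j, seen from x_j, lies in (1 - s) q + U, so it has norm at
    least 1 - s; as it also lies in B(x_j, 1), s is nonnegative.  But then
    p - x_j = (1 - s) q - v lies in the facet shrunk by 1 - s, whence
    |p - x_j| <= 1, contradicting the choice of x_j.  The relative interior is
    dense in H [ball_hull_core_dense], which gives the inclusion.

    The dimensions 0, 1, n - 1 and n are those covered by these two
    arguments. *)

Set Implicit Arguments.
Unset Strict Implicit.
Unset Printing Implicit Defensive.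

Import Order.TTheory GRing.Theory Num.Theory.
Import numFieldNormedType.Exports.

Local Open Scope classical_set_scope.
Local Open Scope ring_scope.

(** * Norms on a finite-dimensional space *)

Lemma rV_linear_bounded (R : realType) (n : nat) (W : normedModType R)
    (f : {linear 'rV[R]_n -> W}) :
  exists2 M, 0 <= M & forall x, `|f x| <= M * `|x|.
Proof.
exists (\sum_i `|f (delta_mx 0 i)|); first by apply: sumr_ge0.
move=> x; rewrite {1}[x]row_sum_delta linear_sum mulr_suml.
apply: le_trans (ler_norm_sum _ _ _) _; apply: ler_sum => i _.
rewrite linearZ normrZ mulrC ler_wpM2l//.
rewrite [leRHS]/Num.norm /= mx_normrE.
by apply: (le_trans _ (le_bigmax _ _ (ord0, i))).
Qed.

Lemma norm_le_bounded_set (R : realType) (V : normedModType R) (A : set V)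
    (M : R) :
  (forall x, A x -> `|x| <= M) -> bounded_set A.
Proof.
move=> AM; exists M; split; first exact: num_real.
by move=> K MK x /AM /le_trans; apply; exact: ltW.
Qed.

Section FiniteDimension.
Variables (R : realType) (n : nat) (N : rV_norm R n).

(** The identity, as a map from the sup-norm topology to that of N: topological
    facts are transported along it. *)
Definition to_normed_rV : 'rV[R]_n -> normed_rV N := id.

Lemma to_normed_rV_linear : linear to_normed_rV.
Proof. by []. Qed.

HB.instance Definition _ := GRing.isLinear.Build R 'rV[R]_n (normed_rV N) *:%R
  to_normed_rV to_normed_rV_linear.

Lemma to_normed_rV_continuous : continuous to_normed_rV.
Proof.
have [M M0 fM] := @rV_linear_bounded R n (normed_rV N) to_normed_rV.
apply: bounded_linear_continuous; apply/bounded_funP => r.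
by exists (M * r) => x xr; apply: le_trans (fM x) _; exact: ler_wpM2l.
Qed.

(** The minimum of N on the compact sup-norm unit sphere is positive because N
    only vanishes at 0; its inverse is the constant.  The sphere is empty when
    n = 0. *)
Lemma sup_norm_le_rV_norm :
  exists2 M, 0 <= M & forall x : 'rV[R]_n, `|x| <= M * N x.
Proof.
pose A := [set x : 'rV[R]_n | `|x| = 1].
have [A0|/set0P A0] := eqVneq A set0.
  exists 0 => // x; rewrite mul0r; have [->|x0] := eqVneq x 0.
    by rewrite normr0.
  have : A (`|x|^-1 *: x).
    by rewrite /A/= normrZ normfV normr_id mulVf// normr_eq0.
  by rewrite A0.
have cN : continuous (fun x : 'rV[R]_n => N x).
  move=> x; have := @norm_continuous _ (normed_rV N) (to_normed_rV x).
  by move=> /(continuous_comp (@to_normed_rV_continuous x)).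
have cA : compact A.
  apply: bounded_closed_compact.
    by apply: (@norm_le_bounded_set _ _ _ 1) => x ->.
  rewrite (_ : A = (Num.norm : 'rV[R]_n -> R) @^-1` [set 1])//.
  apply: closed_comp => [x _|]; last exact: closed_eq.
  exact: (@norm_continuous R 'rV[R]_n).
have [c cA' cmin] := @compact_EVT_min _ _ (fun x : 'rV[R]_n => N x) A A0 cA
  (continuous_subspaceT cN).
rewrite inE/= in cA'.
have Nc : 0 < N c.
  rewrite lt0r; apply/andP; split.
    apply/eqP => /rV_norm0_eq0 c0.
    by move: cA'; rewrite /A/= c0 normr0 => /esym/eqP; rewrite oner_eq0.
  exact: (@normr_ge0 _ (normed_rV N)).
exists (N c)^-1; first by rewrite invr_ge0 ltW.
move=> x; have [->|x0] := eqVneq x 0.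
  rewrite normr0 mulr_ge0 ?invr_ge0 ?(ltW Nc)//.
  exact: (@normr_ge0 _ (normed_rV N)).
rewrite ler_pdivlMl//.
have /cmin : `|x|^-1 *: x \in A.
  by rewrite inE /A/= normrZ normfV normr_id mulVf// normr_eq0.
rewrite rV_normZ normfV normr_id -ler_pdivrMl ?normr_gt0 ?invr_eq0 ?normr_eq0//.
  by rewrite invrK mulrC.
by rewrite invr_gt0 normr_gt0.
Qed.

(** The ball is closed and, by [sup_norm_le_rV_norm], bounded for the sup norm,
    so Heine-Borel applies there and compactness passes to the topology of N. *)
Lemma closed_ball_normed_rV_compact (x : normed_rV N) (r : R) :
  compact (closed_ball_ Num.norm x r).
Proof.
have [M M0 NM] := sup_norm_le_rV_norm.
have -> : closed_ball_ Num.norm x r =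
    to_normed_rV @` (to_normed_rV @^-1` closed_ball_ Num.norm x r).
  by apply/seteqP; split=> [y xy|y [z xz <-]//]; exists y.
apply: continuous_compact.
  exact/continuous_subspaceT/to_normed_rV_continuous.
apply: bounded_closed_compact.
  apply: (@norm_le_bounded_set _ _ _ (M * (`|x| + r))) => y /= xy.
  apply: le_trans (NM y) _; rewrite ler_wpM2l//.
  have -> : N y = `|x - (x - to_normed_rV y)| by rewrite subKr.
  by apply: le_trans (ler_normB _ _) _; rewrite lerD2l.
apply: closed_comp; last exact: closed_closed_ball_.
by move=> y _; exact: to_normed_rV_continuous.
Qed.

Lemma normed_rV_linear_bounded (W : normedModType R)
    (f : {linear normed_rV N -> W}) :
  exists2 M, 0 <= M & forall x, `|f x| <= M * `|x|.
Proof.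
have [M M0 NM] := sup_norm_le_rV_norm.
have [K K0 fK] := @rV_linear_bounded R n W (f \o to_normed_rV).
exists (K * M); first exact: mulr_ge0.
by move=> x; apply: le_trans (fK x) _; rewrite -mulrA ler_wpM2l//; exact: NM.
Qed.

End FiniteDimension.

(** * Ball hulls in a normed space *)

Section BallHull.
Variables (R : realType) (V : normedModType R).
Implicit Types (S T : set V) (x y : V).

Lemma closure_ball_meets S x :
  (forall e, 0 < e -> exists2 y, S y & `|x - y| < e) -> closure S x.
Proof.
move=> Sx B /nbhs_ballP[e /= e0 eB]; have [y Sy xy] := Sx e e0.
by exists y; split=> //; apply: eB; rewrite -ball_normE.
Qed.

Lemma subset_ball_hull S : S `<=` ball_hull S.
Proof. by move=> y Sy x; apply. Qed.

Lemma closed_ball_hull S : closed (ball_hull S).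
Proof. by apply: closed_bigI => x _; exact: closed_closed_ball_. Qed.

Lemma ball_hull_closure S : ball_hull (closure S) = ball_hull S.
Proof.
congr (bigcap _ _); apply/seteqP; split=> x /= Sx.
  by apply: subset_trans Sx; exact: subset_closure.
rewrite (closure_id (closed_ball_ Num.norm x 1)).1; last first.
  exact: closed_closed_ball_.
exact: closure_subset.
Qed.

(** Closed balls are convex. Finite convex combinations come at no extra cost
    from the triangle inequality, without an induction on two-point ones. *)
Lemma ball_hull_sum S (I : finType) (a : I -> R) (s : I -> V) :
  (forall i, 0 <= a i) -> \sum_i a i = 1 -> (forall i, ball_hull S (s i)) ->
  ball_hull S (\sum_i a i *: s i).
Proof.
move=> a0 a1 Ss x Sx; rewrite /closed_ball_/=.
rewrite -[x in x - _]scale1r -a1 scaler_suml -sumrB.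
apply: le_trans (ler_norm_sum _ _ _) _; apply: ler_sum => i _.
by rewrite -scalerBr normrZ ger0_norm// ler_piMr//; exact: Ss.
Qed.

Lemma ball_hull_segment S x y t :
  0 <= t <= 1 -> ball_hull S x -> ball_hull S y ->
  ball_hull S ((1 - t) *: x + t *: y).
Proof.
move=> /andP[t0 t1] Sx Sy.
have := @ball_hull_sum S bool (fun b => if b then t else 1 - t)
  (fun b => if b then y else x).
rewrite !big_bool/= [X in ball_hull S X]addrC subrKC; apply=> // -[]//.
by rewrite subr_ge0.
Qed.

(** Each c in some C i is within 1 of x j for all j >= i, and x j comes
    arbitrarily close to l for such j. *)
Lemma ball_center_cluster (C : nat -> set V) (x : nat -> V) (l : V) :
  (forall i j, (i <= j)%N -> C i `<=` C j) ->
  (forall i, C i `<=` closed_ball_ Num.norm (x i) 1) ->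
  (forall e i, 0 < e -> exists2 j, (i <= j)%N & `|l - x j| < e) ->
  \bigcup_i C i `<=` closed_ball_ Num.norm l 1.
Proof.
move=> Cmono Cx xl c [i _ Cc] /=; apply/ler_addgt0Pr => e e0.
have [j ij lj] := xl e i e0.
rewrite -(subrK (x j) l) -addrA; apply: le_trans (ler_normD _ _) _.
by rewrite [leRHS]addrC lerD ?(ltW lj)//; exact: (Cx j c (Cmono _ _ ij _ Cc)).
Qed.

Lemma line_combination (k u : V) (a b c : R) :
  (1 - c) *: (k + a *: u) + c *: (k + b *: u) =
  k + ((1 - c) * a + c * b) *: u.
Proof.
rewrite !scalerDr !scalerA addrACA -!scalerDl subrK scale1r.
by [].
Qed.

(** Sliding argument: some ball B(x, 1) contains S, and moving it along the line
    towards k by the right amount keeps S inside while expelling p, unless p is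
    in the closure of S.  The amount is found discretely, in steps of
    length h |p - k|, small enough for S to stop more than one
    step before p, so that the exact end of the chord is never needed. *)
Lemma ball_hull_line_sub_closure S k x p :
  (forall y t, 0 <= t <= 1 -> S y -> S ((1 - t) *: k + t *: y)) ->
  S k -> S `<=` closed_ball_ Num.norm x 1 -> ball_hull S p ->
  (forall y, S y -> exists t, y = k + t *: (p - k)) ->
  closure S p.
Proof.
move=> Sstar Sk Sx Hp Sline; apply: contrapT => nSp.
set u := p - k in Sline.
have pE : p = k + u by rewrite /u subrKC.
have u0 : u != 0.
  rewrite subr_eq0; apply/eqP => pk; apply: nSp; rewrite pk.
  exact: subset_closure.
clearbody u; have nu0 : 0 < `|u| by rewrite normr_gt0.
have [h [h0 h1 Sh]] : exists h, [/\ 0 < h, h <= 1 & ~ S (p - h *: u)].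
  apply: contrapT => hS; apply: nSp; apply: closure_ball_meets => e e0.
  pose h := Num.min 1 (e / `|u| / 2).
  have h0 : 0 < h by rewrite lt_min ltr01/= !divr_gt0.
  exists (p - h *: u).
    apply: contrapT => Sh; apply: hS; exists h; split=> //.
    by rewrite ge_min lexx.
  rewrite subKr normrZ gtr0_norm// -ltr_pdivlMr//.
  by rewrite gt_min ltr_pdivrMr// ltr_pMr ?divr_gt0// ltr1n orbT.
have St t : S (k + t *: u) -> t < 1 - h.
  move=> Sy; rewrite ltNge; apply/negP => ht; apply: Sh.
  have [h1'|h1'] := eqVneq h 1.
    by rewrite h1' scale1r pE addrK.
  have t0 : 0 < t by apply: lt_le_trans ht; rewrite subr_gt0 lt_neqAle h1' h1.
  have -> : p - h *: u = (1 - (1 - h) / t) *: k + ((1 - h) / t) *: (k + t *: u).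
    rewrite -{1}[k](addr0 k) -(scale0r u) line_combination mulr0 add0r.
    by rewrite divfK ?gt_eqF// scalerBl scale1r addrA -pE.
  apply: Sstar => //; rewrite divr_ge0 ?subr_ge0 ?(ltW t0)//=.
  by rewrite ler_pdivrMr// mul1r.
(* out m: moved back by m h u, the ball B(x, 1) no longer contains p.  It still
   does for m = 0, because p belongs to the hull. *)
pose out m := 1 < `|x - (k + (1 + m%:R * h) *: u)|.
have outP : exists m, out m.
  pose m := Num.bound ((1 + `|x - k|) / (h * `|u|)); exists m.
  have : (1 + `|x - k|) / (h * `|u|) < m%:R.
    by apply: archi_boundP; rewrite divr_ge0 ?addr_ge0// mulr_ge0 ?ltW.
  rewrite ltr_pdivrMr ?mulr_gt0// => mP; rewrite /out opprD addrA.
  rewrite distrC; apply: lt_le_trans (lerB_dist _ _).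
  rewrite normrZ ger0_norm ?addr_ge0 ?mulr_ge0 ?(ltW h0)//.
  by rewrite ltrBrDr mulrDl mul1r -mulrA ltr_wpDl// ltW.
case: (ex_minnP outP) => -[|m] om mmin.
  have := Hp x Sx; rewrite /closed_ball_/= pE leNgt => /negP; apply.
  by move: om; rewrite /out mul0r addr0 scale1r.
have inm : `|x - (k + (1 + m%:R * h) *: u)| <= 1.
  by rewrite leNgt; apply/negP => /(mmin m); rewrite ltnn.
pose z := x - (m.+1%:R * h) *: u.
have Sz : S `<=` closed_ball_ Num.norm z 1.
  move=> y Sy; have [t yE] := Sline y Sy.
  have tlt : t < 1 - h by apply: St; rewrite -yE.
  have t1 : 0 < 1 + m%:R * h - t.
    rewrite subr_gt0 (lt_trans tlt)// ltrBlDr -addrA ltrDl.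
    by rewrite ltr_wpDl ?mulr_ge0// ltW.
  pose c := m.+1%:R * h / (1 + m%:R * h - t).
  rewrite /closed_ball_/=.
  have -> : z - y = x - ((1 - c) *: y + c *: (k + (1 + m%:R * h) *: u)).
    rewrite yE line_combination /z -addrA -opprD; congr (x - _).
    rewrite addrCA -scalerDl; congr (_ + _ *: _); rewrite /c; field.
    by rewrite gt_eqF.
  apply: (@ball_hull_segment (closed_ball_ Num.norm x 1)) => //.
  - rewrite divr_ge0 ?mulr_ge0 ?(ltW h0) ?(ltW t1)//= ler_pdivrMr// mul1r.
    by move: tlt; rewrite -natr1; lra.
  - by apply: subset_ball_hull; exact: Sx.
  - exact: subset_ball_hull.
have := Hp z Sz; rewrite /closed_ball_/= leNgt => /negP; apply.
suff -> : z - p = x - (k + (1 + m.+1%:R * h) *: u) by [].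
rewrite /z pE -addrA -opprD. congr (x - _).
by rewrite scalerDl scale1r addrCA [in RHS](addrC u).
Qed.

End BallHull.

Section NormedRowVectors.
Variables (R : realType) (n : nat) (N : rV_norm R n).

Lemma closed_ball_seq_cluster (c : normed_rV N) (r : R)
    (x : nat -> normed_rV N) :
  (forall i, closed_ball_ Num.norm c r (x i)) ->
  exists l, forall e i, 0 < e -> exists2 j, (i <= j)%N & `|l - x j| < e.
Proof.
move=> xc.
have [|l [_ lx]] := @closed_ball_normed_rV_compact _ _ _ c r (x @ \oo).

  by exists 0%N => // i _; exact: xc.
exists l => e i e0.
have [|y [/= [j ij <-]]] :=
    lx [set x j | j in [set j | (i <= j)%N]] (ball l e) _ (nbhsx_ballx _ _ e0).
  by exists i => // j /= ij; exists j.
by rewrite -ball_normE; exists j.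
Qed.

(** A set contained in no unit ball has the whole space as ball hull, which is
    unbounded in positive dimension. *)
Lemma b_convex_body_in_ball (A : set (normed_rV N)) : (0 < n)%N ->
  b_convex_body A -> exists x, A `<=` closed_ball_ Num.norm x 1.
Proof.
move=> n0 [Ahull Abounded _]; apply: contrapT => noball.
have AT : A = setT.
  rewrite Ahull -subTset => y _ x Ax; exfalso; apply: noball.
  by exists x; rewrite {1}Ahull => z; apply.
have [M [_ /(_ (M + 1))]] := Abounded.
rewrite ltrDl ltr01 AT => /(_ isT) bndM.
pose v : normed_rV N := const_mx 1.
have v0 : v != 0.
  apply/eqP => /rowP/(_ (Ordinal n0)); rewrite !mxE; apply/eqP.
  exact: oner_neq0.
have := bndM (((`|M| + 2) / `|v|) *: v) I.
rewrite /= normrZ normrM normfV normr_id divfK ?normr_eq0// ger0_norm.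
  by have := ler_norm M; lra.
by rewrite addr_ge0.
Qed.

End NormedRowVectors.

(** * Direction of an affine hull *)

Section FreeFamilies.

(** A free family of maximal size among those drawn from A spans A. *)
Lemma maximal_free_seq (K : fieldType) (V : vectType K) (A : set V) :
  exists X : seq V, [/\ free X, forall x, x \in X -> A x
    & forall x, A x -> x \in <<X>>%VS].
Proof.
pose P k := `[< exists X : seq V,
  [/\ free X, forall x, x \in X -> A x & size X = k] >].
have P0 : exists k, P k.
  by exists 0%N; apply/asboolP; exists [::]; split=> //; rewrite nil_free.
have Pub k : P k -> (k <= \dim {:V})%N.
  by move=> /asboolP[X [/eqP <- _ <-]]; exact: dimvS (subvf _).
case: (ex_maxnP P0 Pub) => k /asboolP[X [frX AX sX]] kmax.
exists X; split=> // x Ax; apply/negPn/negP => xX.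
have /kmax : P k.+1.
  apply/asboolP; exists (x :: X); split; rewrite ?free_cons ?xX//= ?sX//.
  by move=> y; rewrite inE => /orP[/eqP ->|/AX].
by rewrite ltnn.
Qed.

(** The direction of the affine hull is contained in the span of X. *)
Lemma affine_dim_le_size (R : realType) (V : vectType R) (A : set V) (a : V)
    (X : seq V) (d : nat) :
  has_affine_dim (affine_hull A) d -> (forall x, A x -> x - a \in <<X>>%VS) ->
  (d <= size X)%N.
Proof.
move=> [x0 [U [AU <-]]] AX; apply: leq_trans (dim_span X); apply: dimvS.
have hullX u : u \in U -> x0 + u - a \in <<X>>%VS.
  move=> uU; have : affine_hull A (x0 + u) by rewrite AU; exists u.
  move=> [k [c [s [As c1 ->]]]].
  rewrite -[a]scale1r -c1 scaler_suml -sumrB rpred_sum// => i _.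
  by rewrite -scalerBr rpredZ ?AX.
apply/subvP => u uU.
have -> : u = (x0 + u - a) - (x0 + 0 - a).
  by rewrite opprB addrA subrK addr0 [x0 + u]addrC addrK.
by rewrite rpredB ?hullX ?rpred0.
Qed.

Lemma affine_dim_direction (R : realType) (V : vectType R) (A : set V)
    (d : nat) :
  has_affine_dim (affine_hull A) d ->
  exists2 U : {vspace V}, \dim U = d & forall x y, A x -> A y -> x - y \in U.
Proof.
move=> [x0 [U [AU dU]]]; exists U => // x y.
have Ahull z : A z -> z - x0 \in U.
  move=> Az; have : affine_hull A z.
    exists 1%N, (fun=> 1), (fun=> z); split=> //; rewrite big_ord1//.
    by rewrite scale1r.
  by rewrite AU => -[u /= uU <-]; rewrite addrAC subrr add0r.
move=> /Ahull xU /Ahull yU.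
by have := rpredB xU yU; rewrite opprB addrA subrK.
Qed.

End FreeFamilies.

(** * Relative interior of a ball hull *)

Section BallHullCore.
Variables (R : realType) (V : normedModType R).

Lemma ball_hull_simplex (S : set V) (h : V) (k : nat) (w : 'I_k -> V)
    (c : 'I_k -> R) :
  ball_hull S h -> (forall i, ball_hull S (h + w i)) ->
  (forall i, 0 <= c i) -> \sum_i c i <= 1 ->
  ball_hull S (h + \sum_i c i *: w i).
Proof.
move=> Sh Sw c0 c1.
pose b i := if unlift ord0 i is Some j then c j else 1 - \sum_i c i.
pose s i := if unlift ord0 i is Some j then h + w j else h.
have b1 : \sum_(i < k.+1) b i = 1.
  have bE i : b (lift ord0 i) = c i by rewrite /b liftK.
  by rewrite big_ord_recl {1}/b unlift_none (eq_bigr _ (fun i _ => bE i)) subrK.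
have -> : h + \sum_i c i *: w i = \sum_(i < k.+1) b i *: s i.
  rewrite big_ord_recl {1}/b {1}/s !unlift_none.
  rewrite [in RHS](eq_bigr (fun i => c i *: h + c i *: w i)); last first.
    by move=> i _; rewrite /b /s liftK scalerDr.
  by rewrite big_split/= -scaler_suml addrA -scalerDl subrK scale1r.
apply: ball_hull_sum => // i; last by rewrite /s; case: unliftP.
by rewrite /b; case: unliftP => // _; rewrite subr_ge0.
Qed.

(** A point p around which H contains a box p + sum t_i w_i, |t_i| <= d, plays
    the role of a relative interior point: this form needs no topology on the
    span of w.  Such points are obtained by moving h slightly towards the
    barycentre b of the simplex with vertices a and a + w_i. *)
Lemma ball_hull_core_dense (S : set V) (a h : V) (k : nat) (w : 'I_k -> V)
    (e : R) :
  ball_hull S a -> (forall i, ball_hull S (a + w i)) -> ball_hull S h ->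
  0 < e ->
  exists p d, [/\ 0 < d, `|h - p| < e &
    forall t : 'I_k -> R, (forall i, `|t i| <= d) ->
      ball_hull S (p + \sum_i t i *: w i)].
Proof.
move=> Sa Sw Sh e0.
pose m : R := k.+1%:R^-1.
have m0 : 0 < m by rewrite invr_gt0.
pose b := a + m *: \sum_i w i.
pose l := Num.min 1 (e / (`|h - b| + 1)).
have l0 : 0 < l by rewrite lt_min ltr01/= divr_gt0// ltr_wpDl.
exists ((1 - l) *: h + l *: b), (l * m ^+ 2); split.
- by rewrite mulr_gt0 ?exprn_gt0.
- have -> : h - ((1 - l) *: h + l *: b) = l *: (h - b).
    by rewrite scalerBl scale1r scalerBr opprD opprB addrA subrKC.
  rewrite normrZ gtr0_norm//.
  apply: (@le_lt_trans _ _ (e / (`|h - b| + 1) * `|h - b|)).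
    by rewrite ler_wpM2r// ge_min lexx orbT.
  by rewrite mulrAC ltr_pdivrMr ?ltr_wpDl// ltr_pM2l// ltrDl.
move=> t td.
have -> : (1 - l) *: h + l *: b + \sum_i t i *: w i =
    (1 - l) *: h + l *: (a + \sum_i (m + t i / l) *: w i).
  rewrite -addrA; congr (_ + _); rewrite !scalerDr !scaler_sumr -addrA.
  congr (_ + _); rewrite -big_split/=; apply: eq_bigr => i _.
  by rewrite !scalerA -scalerDl mulrDr [l * (_ / _)]mulrC divfK ?gt_eqF.
apply: ball_hull_segment => //; first by rewrite (ltW l0) ge_min lexx.
(* The size d = l m^2 with m = 1 / (k + 1) keeps the perturbed barycentric
   coordinates m + t_i / l nonnegative, with a sum of at most
   k (m + m^2) = 1 - m^2. *)
have tl i : `|t i / l| <= m ^+ 2.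
  by rewrite normrM normfV (gtr0_norm l0) ler_pdivrMr// mulrC.
have km : k.+1%:R * m = 1 by rewrite mulfV.
have m1 : m <= 1 by rewrite invf_le1// ler1n.
apply: ball_hull_simplex => // [i|].
  have := tl i; rewrite ler_norml => /andP[+ _].
  have : m ^+ 2 <= m by rewrite expr2 ler_piMl// ltW.
  lra.
apply: (@le_trans _ _ (\sum_(i < k) (m + m ^+ 2))).
  apply: ler_sum => i _; rewrite lerD2l.
  by apply: le_trans (tl i); exact: ler_norm.
rewrite sumr_const card_ord -mulr_natl.
move: km; rewrite -natr1; nra.
Qed.

End BallHullCore.
(** * Ball hulls of codimension at most one *)

Section Facet.
Variables (R : realType) (V : normedModType R).

(** By convexity: were |q + u| < 1, then q, which lies strictly between q + u
    and a point q - h u of norm at most 1, would have norm less than 1. *)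
Lemma facet_norm_ge1 (k : nat) (w : 'I_k -> V) (q : V) (d : R) :
  0 < d -> 1 <= `|q| ->
  (forall t : 'I_k -> R, (forall i, `|t i| <= d) ->
    `|q + \sum_i t i *: w i| <= 1) ->
  forall a : 'I_k -> R, 1 <= `|q + \sum_i a i *: w i|.
Proof.
move=> d0 q1 qd a.
set u := \sum_i a i *: w i.
pose m := 1 + \sum_i `|a i|.
have m0 : 0 < m by rewrite ltr_wpDr ?sumr_ge0.
pose h := d / m.
have h0 : 0 < h by rewrite divr_gt0.
have qhu : `|q - h *: u| <= 1.
  have -> : q - h *: u = q + \sum_i (- (h * a i)) *: w i.
    rewrite /u scaler_sumr -sumrN; congr (_ + _); apply: eq_bigr => i _.
    by rewrite scalerA scaleNr.
  apply: qd => i; rewrite normrN normrM gtr0_norm// /h mulrAC ler_pdivrMr//.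
  by rewrite ler_pM2l// /m (bigD1 i)//= addrCA lerDl addr_ge0 ?sumr_ge0.
have : (1 + h) * `|q| <= h * `|q + u| + 1.
  have h1 : 0 < 1 + h by rewrite addr_gt0.
  have hE y c : 0 < c -> c * `|y| = `|c *: y : V|.
    by move=> c0; rewrite normrZ gtr0_norm.
  rewrite !hE//; apply: le_trans (lerD (lexx _) qhu).
  apply: le_trans (ler_normD _ _).
  by rewrite scalerDr addrACA subrr addr0 scalerDl scale1r addrC.
nra.
Qed.

End Facet.

Section Core.
Variables (R : realType) (n : nat) (N : rV_norm R n).

(** The facet argument: were p outside every C i, unit balls B(x i, 1)
    containing C i but not p would accumulate at a ball having a facet around
    p, and near a facet a translated ball cannot lose p without losing the
    whole hyperplane of the facet, hence C i.  The hypothesis on k says that w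
    spans a subspace of codimension at most one. *)
Lemma ball_hull_core_sub_bigcup (C : nat -> set (normed_rV N)) (p : normed_rV N)
    (k : nat) (w : k.-tuple (normed_rV N)) (d : R) :
  (forall i, C i = ball_hull (C i)) -> (forall i, C i !=set0) ->
  (forall i j, (i <= j)%N -> C i `<=` C j) ->
  free w -> (n <= k.+1)%N ->
  (forall c, (\bigcup_i C i) c -> c - p \in <<w>>%VS) ->
  0 < d ->
  (forall t : 'I_k -> R, (forall i, `|t i| <= d) ->
    ball_hull (\bigcup_i C i) (p + \sum_i t i *: w`_i)) ->
  exists i, C i p.
Proof.
move=> Chull Cn0 Cmono frw nk Cw d0 pH; apply: contrapT => Cp.
have /choice[x xP] : forall i, exists x : normed_rV N,
    C i `<=` closed_ball_ Num.norm x 1 /\ 1 < `|x - p|.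
  move=> i; apply: contrapT => nx; apply: Cp; exists i; rewrite Chull => x Cx.
  by rewrite /closed_ball_/= leNgt; apply/negP => xp; apply: nx; exists x.
have [c0 Cc0] := Cn0 0%N.
have [|l lx] := @closed_ball_seq_cluster _ _ _ c0 1 x.
  move=> i; rewrite /closed_ball_/= distrC; apply: (xP i).1.
  exact: (Cmono 0%N i).
have Cl : \bigcup_i C i `<=` closed_ball_ Num.norm l 1.
  by apply: ball_center_cluster lx => // i; exact: (xP i).1.
have [q qE] : {q | q = p - l} by exists (p - l).
have q1 : 1 <= `|q|.
  apply/ler_addgt0Pr => e e0; have [j _ lj] := lx e 0%N e0.
  apply: le_trans (ltW (xP j).2) _; rewrite qE.
  apply: le_trans (ler_distD l _ _) _.
  by rewrite addrC [`|l - p|]distrC [`|x j - l|]distrC lerD2l ltW.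
have qd (t : 'I_k -> R) : (forall i, `|t i| <= d) ->
    `|q + \sum_i t i *: w`_i| <= 1.
  by move=> /pH /(_ l Cl); rewrite /closed_ball_/= distrC qE addrAC.
have qw1 u : u \in <<w>>%VS -> 1 <= `|q + u|.
  by move=> /coord_span ->; exact: facet_norm_ge1 d0 q1 qd _.
have qw : q \notin <<w>>%VS.
  apply/negP; rewrite -rpredN => /qw1; rewrite subrr normr0.
  by rewrite leNgt ltr01.
pose Y := [tuple of q :: w].
have bY : basis_of {:normed_rV N} Y.
  rewrite basisEfree /= free_cons qw frw subvf /= size_tuple.
  by rewrite dimvf /dim /= mul1n.
have [M M0 coordM] : exists2 M, 0 <= M &
    forall i (z : normed_rV N), `|coord Y i z| <= M * `|z|.
  have /choice[M MP] : forall i, exists M, 0 <= M /\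
      forall (z : normed_rV N), `|coord Y i z| <= M * `|z|.
    move=> i; have [M M0 MP] := @normed_rV_linear_bounded _ _ N R^o (coord Y i).
    by exists M.
  exists (\sum_i M i); first by apply: sumr_ge0 => i _; exact: (MP i).1.
  move=> i z; apply: le_trans ((MP i).2 z) _; rewrite ler_wpM2r//.
  rewrite (bigD1 i)//= lerDl sumr_ge0// => j _; exact: (MP j).1.
(* s <= 1/2 keeps 1 - s >= 1/2, and then |t_i| <= d / 2 gives
   |t_i / (1 - s)| <= d. *)
pose r := Num.min 1 d / 2.
have r0 : 0 < r by rewrite divr_gt0// lt_min ltr01.
have [|j _ lj] := lx (r / (M + 1)) 0%N; first by rewrite divr_gt0// ltr_wpDl.
pose z := x j - l.
have coordr i : `|coord Y i z| <= r.
  apply: le_trans (coordM i z) _.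
  apply: (@le_trans _ _ (M * (r / (M + 1)))).
    by rewrite ler_wpM2l// /z distrC ltW.
  by rewrite mulrCA ler_piMr ?(ltW r0)// ler_pdivrMr ?ltr_wpDl// mul1r lerDl.
pose s := coord Y ord0 z.
pose t i := coord Y (lift ord0 i) z.
have zE : z = s *: q + \sum_i t i *: w`_i.
  rewrite {1}(coord_basis bY (memvf z)) big_ord_recl; congr (_ + _).
have s2 : `|s| <= 2^-1.
  apply: le_trans (coordr _) _; rewrite /r ler_pdivrMr// mulVf//.
  by rewrite ge_min lexx.
have s1 : 0 < 1 - s.
  by have := ler_norm s; move: s2; lra.
have tw : \sum_i t i *: w`_i \in <<w>>%VS.
  by apply: rpred_sum => i _; rewrite rpredZ// memv_span// mem_nth// size_tuple.
(* Any point of C j lies in the hyperplane of the facet and in B(x j, 1): the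
   centre x j has not moved away from this hyperplane. *)
have s0 : 0 <= s.
  have [c Cc] := Cn0 j.
  have cw : c - p \in <<w>>%VS by apply: Cw; exists j.
  pose u := c - p - \sum_i t i *: w`_i.
  have /qw1 qu : (1 - s)^-1 *: u \in <<w>>%VS by rewrite rpredZ// rpredB.
  have : `|c - x j| <= 1 by rewrite distrC; exact: (xP j).1.
  have -> : c - x j = (1 - s) *: (q + (1 - s)^-1 *: u).
    rewrite scalerDr scalerA mulfV ?gt_eqF// scale1r scalerBl scale1r.
    have -> : c - x j = (c - p) + q - z.
      by rewrite qE /z opprB !addrA !subrK.
    by rewrite zE /u opprD [c - p + q]addrC addrACA.
  rewrite normrZ gtr0_norm// => h.
  have : (1 - s) * 1 <= 1 by apply: le_trans h; rewrite ler_pM2l.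
  by rewrite mulr1; lra.
(* As x j has not moved away from the facet, the facet shrunk by
   1 - s about x j is contained in B(x j, 1), and it still contains p. *)
have := (xP j).2; rewrite ltNge => /negP; apply.
have -> : x j - p = - ((1 - s) *: (q + \sum_i (- (t i / (1 - s))) *: w`_i)).
  have -> : x j - p = - (q - z) by rewrite opprB qE /z opprB addrA subrK.
  congr (- _); rewrite zE scalerDr scalerBl scale1r opprD addrA; congr (_ + _).
  rewrite scaler_sumr -sumrN; apply: eq_bigr => i _.
  by rewrite scalerA mulrN mulrC divfK ?gt_eqF// scaleNr.
rewrite normrN normrZ gtr0_norm//.
apply: (@le_trans _ _ (1 - s)); last by rewrite gerBl.
rewrite ger_pMr//; apply: qd => i.
rewrite normrN normrM normfV (gtr0_norm s1) ler_pdivrMr//.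
apply: le_trans (coordr _) _; rewrite /r.
have : Num.min 1 d <= d by rewrite ge_min lexx orbT.
have := ler_norm s; move: s2; nra.
Qed.

End Core.

(** * Increasing unions of b-convex bodies *)

Section IncreasingUnion.
Variables (R : realType) (n : nat) (N : rV_norm R n).
Variable C : nat -> set (normed_rV N).
Hypotheses (Cbody : forall i, b_convex_body (C i))
  (Cmono : forall i j, (i <= j)%N -> C i `<=` C j).
Local Notation S := (\bigcup_i C i).

Lemma bigcup_in_ball : (0 < n)%N ->
  exists x, S `<=` closed_ball_ Num.norm x 1.
Proof.
move=> n0; have /choice[x Cx] i := b_convex_body_in_ball n0 (Cbody i).
have [_ _ [c Cc]] := Cbody 0%N.
have [|l lx] := @closed_ball_seq_cluster _ _ _ c 1 x.
  by move=> i; rewrite /closed_ball_/= distrC; exact/Cx/(Cmono (leq0n i)).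
by exists l; exact: ball_center_cluster lx.
Qed.

Lemma ball_hull_sub_closure_low_dim (U : {vspace normed_rV N}) : (0 < n)%N ->
  (\dim U <= 1)%N ->
  (forall x y, ball_hull S x -> ball_hull S y -> x - y \in U) ->
  ball_hull S `<=` closure S.
Proof.
move=> n0 U1 HU p Hp; have [x Sx] := bigcup_in_ball n0.
have [_ _ [k Ck]] := Cbody 0%N; have Sk : S k by exists 0%N.
have [->|pk] := eqVneq p k; first exact: subset_closure.
have UE : U = <[p - k]>%VS.
  apply/eqP; rewrite eq_sym -(geq_leqif (dimv_leqif_eq _)).
    by rewrite dim_vline subr_eq0 pk.
  by rewrite -memvE; apply: HU => //; exact: subset_ball_hull.
apply: (ball_hull_line_sub_closure _ Sk Sx Hp) => [y t t01 [i _ Cy]|y Sy].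
  have [+ _ _] := Cbody i => Ci; exists i => //; rewrite Ci.
  by apply: ball_hull_segment => //; rewrite -Ci//; exact: Cmono Ck.
have : y - k \in U by apply: HU; exact: subset_ball_hull.
by rewrite UE => /vlineP[t yk]; exists t; rewrite -yk subrKC.
Qed.

Lemma ball_hull_sub_closure_high_dim (d : nat) :
  has_affine_dim (affine_hull (ball_hull S)) d -> (n <= d.+1)%N ->
  ball_hull S `<=` closure S.
Proof.
move=> Hd nd h Hh.
have [_ _ [a Ca]] := Cbody 0%N.
have Ha : ball_hull S a by apply: subset_ball_hull; exists 0%N.
have [X [frX XH HX]] := maximal_free_seq [set v | ball_hull S (a + v)].
pose w := in_tuple X.
have HXa x : ball_hull S x -> x - a \in <<X>>%VS.
  by move=> Hx; apply: HX; rewrite /= subrKC.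
have dX := affine_dim_le_size Hd HXa.
apply: closure_ball_meets => e e0.
have Hw (i : 'I_(size X)) : ball_hull S (a + w`_i).
  by apply: XH; exact: mem_nth.
have [p [r [r0 hp pH]]] := ball_hull_core_dense Ha Hw Hh e0.
exists p => //.
have Hp : ball_hull S p.
  have := pH (fun=> 0); rewrite big1 ?addr0; last first.
    by move=> i _; rewrite scale0r.
  by apply=> i; rewrite normr0 ltW.
have [i Cp] : exists i, C i p.
  apply: (@ball_hull_core_sub_bigcup _ _ _ C p _ w r) => //.
  - by move=> i; have [] := Cbody i.
  - by move=> i; have [] := Cbody i.
  - by apply: leq_trans nd _; rewrite ltnS.
  - move=> c Sc; have -> : c - p = (c - a) - (p - a).
      by rewrite opprB addrA subrK.
    by rewrite rpredB// HXa//; exact: subset_ball_hull.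
by exists i.
Qed.

End IncreasingUnion.

Unset Implicit Arguments.

Theorem theorem1 (R : realType) (n : nat) (n_ge1 : (1 <= n)%N)
    (N : rV_norm R n) (C : nat -> set (normed_rV N))
    (C_body : forall i : nat, b_convex_body (C i))
    (C_incr : forall i : nat, C i `<=` C i.+1)
    (C_dim : exists d : nat,
       has_affine_dim (affine_hull (ball_hull (\bigcup_i C i))) d
       /\ d \in [:: 0; 1; n.-1; n]%N) :
  closure (\bigcup_i C i) = ball_hull (\bigcup_i C i)
  /\ b_convex_body (closure (\bigcup_i C i)).
Proof.
have Cmono i j : (i <= j)%N -> C i `<=` C j.
  move=> /subnK <-; elim: (j - i)%N => // m IH; rewrite addSn.
  exact: subset_trans IH (C_incr _).
have clE : closure (\bigcup_i C i) = ball_hull (\bigcup_i C i).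
  apply/seteqP; split.
    rewrite (closure_id (ball_hull _)).1; last exact: closed_ball_hull.
    by apply: closure_subset; exact: subset_ball_hull.
  have [d [Hd d4]] := C_dim.
  have [d1|d1] := leqP d 1.
    have [U Ud HU] := affine_dim_direction Hd.
    by apply: (@ball_hull_sub_closure_low_dim _ _ _ _ _ _ U); rewrite ?Ud.
  apply: (@ball_hull_sub_closure_high_dim _ _ _ _ C_body Cmono d) => //.
  by move: d4 d1; rewrite !inE => /or4P[] /eqP -> //; rewrite prednK.
split=> //; split.
- by rewrite /b_convex ball_hull_closure.
- have [x Sx] := bigcup_in_ball C_body Cmono n_ge1.
  apply: (@norm_le_bounded_set _ _ _ (`|x| + 1)) => y.
  rewrite clE => /(_ x Sx) xy.
  have -> : y = x - (x - y) by rewrite subKr.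
  by apply: le_trans (ler_normB _ _) _; rewrite lerD2l.
- have [_ _ [c Cc]] := C_body 0%N; exists c; apply: subset_closure.
  by exists 0%N.
Qed.
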